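(* Let $n,m$ be positive integers and $a_1,\dots,a_m\in\{0,1\}$, and suppose the Toeplitz graph $G_n(a_1a_2\cdots a_m)$ is word-representable. Then for each positive divisor $d$ of $m$, the Toeplitz graph $G_{\lfloor n/d\rfloor}(a_da_{2d}\cdots a_m)$ is word-representable.
   Context: For a word $b_1b_2\cdots b_p$ over $\{0,1\}$, the Toeplitz graph $G_N(b_1b_2\cdots b_p)$ is the simple graph on vertex set $[N]=\{1,\dots,N\}$ in which distinct vertices $x,y$ are adjacent if and only if $b_r=1$, where $r\in[p]$ is such that $r\equiv |x-y|\pmod p$. (Equivalently it is the Riordan graph $G_N\big(\frac{b_1+b_2z+\cdots+b_pz^{p-1}}{1-z^p},z\big)$.) The word $a_da_{2d}\cdots a_m$ has length $m/d$. Two distinct letters $x,y$ alternate in a word $w$ if deleting all other letters from $w$ yields a word of the form $xyxy\cdots$ or $yxyx\cdots$ (of even or odd length). A graph $G=(V,E)$ is word-representable if there is a word $w$ over the alphabet $V$ such that for all distinct $x,y\in V$, $x$ and $y$ alternate in $w$ if and only if $xy\in E$. *)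

(* Defs.v *)
From mathcomp Require Export all_boot.
From mathcomp Require Export ssrint.

Set Implicit Arguments.
Unset Strict Implicit.
Unset Printing Implicit Defensive.

(* The word x y x y ... of length k, of either parity. *)
Definition alt_word (V : Type) (x y : V) (k : nat) : seq V :=
  mkseq (fun i => if odd i then y else x) k.

Definition alternate (V : eqType) (x y : V) (w : seq V) : Prop :=
  exists k, [seq z <- w | (z == x) || (z == y)] = alt_word x y k
         \/ [seq z <- w | (z == x) || (z == y)] = alt_word y x k.

Definition word_representable (V : finType) (E : rel V) : Prop :=
  exists w : seq V, forall x y : V, x != y -> (alternate x y w <-> E x y).

(* Letters of a word are numbered from 1: b_1 b_2 ... b_p. *)
Definition letter (p : nat) (b : p.-tuple bool) (r : nat) : bool :=
  nth false b r.-1.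

(* The ordinal i : 'I_N stands for the vertex i + 1 of {1, ..., N}; the shift
   leaves |x - y| unchanged. *)
Definition toeplitz_graph (N p : nat) (b : p.-tuple bool) : rel 'I_N :=
  fun x y => (x != y) &&
    has (fun r => (r == `|x - y| %[mod p]) && letter b r) (iota 1 p).

Lemma toeplitz_graph_irrefl (N p : nat) (b : p.-tuple bool) :
  irreflexive (toeplitz_graph (N := N) b).
Proof. by move=> x; rewrite /toeplitz_graph eqxx. Qed.

Lemma toeplitz_graph_sym (N p : nat) (b : p.-tuple bool) :
  symmetric (toeplitz_graph (N := N) b).
Proof. by move=> x y; rewrite /toeplitz_graph eq_sym distnC. Qed.

(* The word a_d a_{2d} ... a_m when d divides m. *)
Definition every_dth (m : nat) (a : m.-tuple bool) (d : nat) :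
    (m %/ d).-tuple bool :=
  [tuple letter a (i.+1 * d) | i < m %/ d].

(* Main.v *)
Require Import Defs.
From mathcomp Require Import ssralg.

(* Word-representability passes to induced subgraphs, since deleting letters
   from a word preserves alternation of the remaining ones. The vertices that
   are multiples of d induce in the large Toeplitz graph a copy of the small
   one, because r = |x - y| mod m/d iff rd = |xd - yd| mod m, and every residue
   of a multiple of d modulo m is itself a multiple of d. *)

Lemma map_alt_word (U V : Type) (f : V -> U) (x y : V) (k : nat) :
  map f (alt_word x y k) = alt_word (f x) (f y) k.
Proof. by rewrite -map_comp; apply: eq_map => i /=; case: odd. Qed.

(** The two cancellation laws make [g] the inverse of [f], defined exactly on its image, so [pmap g]
    at once deletes the letters outside that image and renames the others. *)
Lemma alternate_pmap (U V : eqType) (f : V -> U) (g : U -> option V)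
    (x y : V) (w : seq U) :
  pcancel f g -> ocancel g f ->
  alternate x y (pmap g w) <-> alternate (f x) (f y) w.
Proof.
move=> fK gK; have f_inj := pcan_inj fK.
have filterE : [seq z <- w | (z == f x) || (z == f y)]
    = map f [seq z <- pmap g w | (z == x) || (z == y)].
  elim: w => //= u w ->; case gu: (g u) => [v|] /=.
    have <- : f v = u by have := gK u; rewrite gu.
    by rewrite !(inj_eq f_inj); case: ifP.
  (* A deleted letter lies outside the image of [f], so the filter drops it too. *)
  case: ifP => // /orP[] /eqP ufx; by rewrite ufx fK in gu.
split=> -[k] alt; exists k; move: alt; rewrite filterE -!map_alt_word.
  by case=> ->; [left|right].
by case=> /(inj_map f_inj); [left|right].
Qed.

Lemma word_representable_induced (U V : finType) (f : V -> U)
    (E : rel U) (F : rel V) :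
  injective f -> (forall x y, x != y -> F x y = E (f x) (f y)) ->
  word_representable E -> word_representable F.
Proof.
move=> f_inj FE [w wP]; pose g u := [pick v | f v == u].
have fK : pcancel f g.
  by move=> v; rewrite /g; case: pickP => [v' /eqP/f_inj->|/(_ v)/eqP].
have gK : ocancel g f by move=> u; rewrite /g; case: pickP => //= v /eqP.
exists (pmap g w) => x y xy.
rewrite FE //; apply: iff_trans (alternate_pmap _ _ _ _ _ _ _ fK gK) _.
by apply: wP; rewrite (inj_eq f_inj).
Qed.

(** Positivity of [r] matters: at 0 the truncated [r.-1] would read [a_d] on the left but [a_1] on
    the right. *)
Lemma letter_every_dth (m : nat) (a : m.-tuple bool) (d r : nat) :
  0 < r <= m %/ d -> letter (every_dth a d) r = letter a (r * d).
Proof.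
case: r => // r /= r_lt; rewrite {1}/letter /=.
rewrite (nth_map (Ordinal r_lt)) ?size_enum_ord //.
by rewrite nth_enum_ord.
Qed.

Lemma toeplitz_letters_every_dth (m : nat) (a : m.-tuple bool) (d k : nat) :
  0 < d -> d %| m ->
  has (fun r => (r == k %[mod m %/ d]) && letter (every_dth a d) r)
      (iota 1 (m %/ d))
  = has (fun r => (r == k * d %[mod m]) && letter a r) (iota 1 m).
Proof.
move=> d_gt0 d_dvd; have mE := divnK d_dvd.
have modE r : (r * d == k * d %[mod m]) = (r == k %[mod m %/ d]).
  by rewrite -{1 2}mE -!muln_modl eqn_pmul2r.
(* The witnesses correspond by [q <-> q * d], which matches the range from 1 to [m %/ d] with the
   multiples of [d] from 1 to [m]. *)
apply/hasP/hasP => -[r]; rewrite mem_iota add1n ltnS => rP /andP[rk ar].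
  exists (r * d); last by rewrite modE rk -letter_every_dth.
  by rewrite mem_iota add1n ltnS muln_gt0 d_gt0 andbT -leq_divRL.
have /dvdnP[q rE] : d %| r.
  by rewrite /dvdn -(modn_dvdm r d_dvd) (eqP rk) modn_dvdm // modnMl.
move: rP; rewrite rE muln_gt0 d_gt0 andbT -leq_divRL // => qP.
exists q; first by rewrite mem_iota add1n ltnS.
by rewrite -modE -rE rk letter_every_dth // -rE.
Qed.

Theorem theorem9 (n m : nat) (a : m.-tuple bool) :
  0 < n -> 0 < m ->
  word_representable (@toeplitz_graph n m a) ->
  forall d : nat, 0 < d -> d %| m ->
    word_representable (@toeplitz_graph (n %/ d) (m %/ d) (every_dth a d)).
Proof.
move=> _ _ + d d_gt0 d_dvd.
(* Ordinals count from 0, so the chosen vertices of [n] are 1, d + 1, 2d + 1, and so on; only their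
   differences matter. *)
have mul_lt (i : 'I_(n %/ d)) : i * d < n.
  by apply: (@leq_trans (i.+1 * d)); rewrite ?ltn_pmul2r // -leq_divRL.
pose f i := Ordinal (mul_lt i).
have f_inj : injective f.
  by move=> i j [] /eqP; rewrite eqn_pmul2r // => /eqP /val_inj.
apply: (word_representable_induced _ _ _ _ _ f_inj) => x y xy.
rewrite /toeplitz_graph (inj_eq f_inj) xy !andTb.
by rewrite toeplitz_letters_every_dth //= !PoszM -GRing.mulrBl abszM.
Qed.
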